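(* Let $p(\cdot)$ be a given probability density function on $\mathbb{R}$. Suppose that the functions $\mu$ and $\sigma$ satisfy $$\sigma^2(z)=2\,\frac{\int_{-\infty}^{z}\mu(z')p(z')\,dz'}{p(z)} .$$ Then the stationary probability density function of the Itô process $Z_t$ defined by $dZ_t=\mu(Z_t)\,dt+\sigma(Z_t)\,dW_t$ is $p$.
   Context: $W_t$ is a standard one-dimensional Wiener process; $\mu$ is the (scalar) drift function and $\sigma$ the (scalar) diffusion function. A stationary PDF of $Z_t$ is a probability density that solves the steady-state Fokker–Planck equation of the diffusion, $\frac12\frac{\partial^2(\sigma^2(z)p(z))}{\partial z^2}=\frac{\partial(\mu(z)p(z))}{\partial z}$.
   Formalization: It is added that p vanishes nowhere, that μp is integrable on each half-line (-∞,z], and that μp is differentiable, without which the Fokker–Planck equation is undefined; ''the stationary density is p'' is read as ''p is a stationary density'', since uniqueness fails (e.g. μ=σ=0). *)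

(* Defs.v *)
From mathcomp Require Import all_boot all_order all_algebra.
From mathcomp Require Import all_classical all_reals all_analysis.

Set Implicit Arguments.
Unset Strict Implicit.
Unset Printing Implicit Defensive.

Import Order.TTheory GRing.Theory Num.Theory.
Import numFieldNormedType.Exports.

Local Open Scope classical_set_scope.
Local Open Scope ring_scope.

Definition is_pdf (R : realType) (p : R -> R) : Prop :=
  [/\ measurable_fun setT p,
      forall z, 0 <= p z &
      (\int[lebesgue_measure]_z (p z)%:E = 1)%E].

(* p is a classical solution of the steady-state Fokker-Planck equation
   (1/2) (sigma^2 p)'' = (mu p)' of dZ = mu(Z) dt + sigma(Z) dW. The derivability
   clauses matter: [derive1] is a total operator whose value is meaningless where
   the derivative does not exist. *)
Definition solves_steady_fokker_planck (R : realType) (mu sigma p : R -> R)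
    : Prop :=
  let v : R -> R := fun z => sigma z ^+ 2 * p z in
  let w : R -> R := fun z => mu z * p z in
  [/\ forall z, derivable v z 1,
      forall z, derivable (derive1 v) z 1,
      forall z, derivable w z 1 &
      forall z, 2^-1 * derive1n 2 v z = derive1 w z].

Definition is_stationary_pdf (R : realType) (mu sigma p : R -> R) : Prop :=
  is_pdf p /\ solves_steady_fokker_planck mu sigma p.

(* Main.v *)
(* The hypothesis on sigma says that sigma^2 p = 2 F, where F is the primitive of
   mu p from -oo; as mu p is continuous, the fundamental theorem of calculus gives
   (sigma^2 p)' = 2 mu p, and differentiating once more gives Fokker-Planck. *)
Require Import Defs.
From mathcomp Require Import all_boot all_order all_algebra.
From mathcomp Require Import all_classical all_reals all_analysis.

Import Order.TTheory GRing.Theory Num.Theory.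
Import numFieldNormedType.Exports.

Local Open Scope classical_set_scope.
Local Open Scope ring_scope.

Theorem proposition1 (R : realType) (mu sigma p : R -> R)
  (p_pdf : is_pdf p)
  (p_neq0 : forall z : R, p z != 0)
  (mup_integrable : forall z : R,
    lebesgue_measure.-integrable `]-oo, z] (fun z' => (mu z' * p z')%:E))
  (mup_derivable : forall z : R, derivable (fun z' : R => mu z' * p z') z 1)
  (sigma_def : forall z : R,
    sigma z ^+ 2 =
    2 * (\int[lebesgue_measure]_(z' in `]-oo, z]) (mu z' * p z')) / p z) :
  is_stationary_pdf mu sigma p.
Proof.
set w := fun z : R => mu z * p z.
set F := fun z : R => \int[lebesgue_measure]_(z' in `]-oo, z]) w z'.
have dF (z : R) : is_derive z 1 F (w z).
  have wz : {for z, continuous w}.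
    exact/differentiable_continuous/derivable1_diffP/mup_derivable.
  (* Differentiating [F] at [z] involves values of [F] on both sides of [z], so [w] must be
     integrable up to some point beyond [z]; [z + 1] is an arbitrary choice. *)
  have zz1 : z < z + 1 by rewrite ltrDl.
  have [dFz F'z] := continuous_FTC1 zz1 (mup_integrable (z + 1)) (ltNyr z) wz.
  by apply: DeriveDef => //; rewrite -derive1E.
have vE : (fun z => sigma z ^+ 2 * p z) = 2 *: F.
  (* [p_neq0] is what lets [p z] cancel: where [p z = 0], the total division would make the left
     side 0 whatever [F z] is. *)
  by apply/funext => z; rewrite sigma_def divfK.
have dv (z : R) : is_derive z 1 (2 *: F) (2 * w z).
  exact: is_deriveZ.
have v'E : derive1 (2 *: F) = 2 *: w.
  by apply/funext => z; rewrite derive1E derive_val.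
split=> //; rewrite /solves_steady_fokker_planck vE; split=> // z.
- by rewrite v'E; exact: derivableZ.
- rewrite derive1nS derive1n1 v'E !derive1E deriveZ//.
  (* On [R], scaling is multiplication, so the factor 1/2 cancels the 2 in [2 *: w]. *)
  by rewrite -[2^-1 * _]/(2^-1 *: _) scalerA mulVf// scale1r.
Qed.
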